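(* Let $k$ be a field. (i) A word $w\in F_k$ belongs to $\mathcal A$ if and only if it can be written as $w=p_1\delta_1p_2\delta_2\cdots p_n\delta_np_{n+1}$ for some $n\ge0$, with $p_1,\dots,p_{n+1}\in\mathcal P$ and $\delta_1,\dots,\delta_n\in k$; moreover, for $w\in\mathcal A$ such a factorization is unique. (ii) If $k$ is the finite field with $q$ elements, then $\#\mathcal P^l=(q-1)^{l-1}$ for every $l\ge1$.
   Context: For a field $k$, let $F_k$ be the free monoid of all finite words with letters in $k$ (concatenation as product), $F_k^l$ the words of length $l$. For $\alpha\in k$ put $M_\alpha=\begin{pmatrix}0&-1\\1&\alpha\end{pmatrix}$ and $\pi(\alpha_1\cdots\alpha_l)=M_{\alpha_1}\cdots M_{\alpha_l}\in\mathrm{SL}_2(k)$ (identity for the empty word). Let $\mathcal A$ be the set of words $w$ with $\pi(w)$ having lower-right entry $0$ (equivalently $\pi(w)=\begin{pmatrix}a&-b\\ b^{-1}&0\end{pmatrix}$, $a\in k$, $b\in k^*$), $\mathcal C=F_k\setminus\mathcal A$, $\mathcal A^l=\mathcal A\cap F_k^l$, $\mathcal C^l=\mathcal C\cap F_k^l$. For $l\ge1$ let $\mathcal P^l=\{\alpha_1\cdots\alpha_l\in\mathcal A^l : \alpha_1\cdots\alpha_h\in\mathcal C^h \text{ for } h=1,\dots,l-1\}$ and $\mathcal P=\bigcup_{l\ge1}\mathcal P^l$. *)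

(* Defs.v *)
From HB Require Import structures.
From mathcomp Require Import all_boot all_order all_algebra.
Set Implicit Arguments.
Unset Strict Implicit.
Unset Printing Implicit Defensive.
Import GRing.Theory.
Local Open Scope ring_scope.

Section Words.
Variable k : fieldType.

(* Words with letters in k are terms of type seq k. *)

Definition letter_mx (alpha : k) : 'M[k]_2 :=
  \matrix_(i < 2, j < 2)
    nth 0 (nth [::] [:: [:: 0; -1]; [:: 1; alpha]] i) j.

Definition word_mx (w : seq k) : 'M[k]_2 := \prod_(alpha <- w) letter_mx alpha.

(* ord_max : 'I_2 is the index of the second row and column. *)
Definition wordA : {pred seq k} :=
  [pred w | word_mx w ord_max ord_max == 0].

Definition wordC : {pred seq k} := [predC wordA].

Definition wordA_len (l : nat) : {pred seq k} :=
  [pred w | (w \in wordA) && (size w == l)].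

Definition wordC_len (l : nat) : {pred seq k} :=
  [pred w | (w \in wordC) && (size w == l)].

(* Only meant for 1 <= l: wordP_len 0 is empty because the empty word is not
   in wordA. *)
Definition wordP_len (l : nat) : {pred seq k} :=
  [pred w | (w \in wordA_len l) &&
            [forall h : 'I_l, (0 < h)%N ==> (take h w \in wordC_len h)]].

Definition wordP (w : seq k) : Prop :=
  exists2 l : nat, (1 <= l)%N & w \in wordP_len l.

(* p_1 d_1 p_2 d_2 ... p_n d_n p_(n+1), for ps of size n.+1 and ds of size n:
   zip drops the last item of ps. *)
Definition interleave (ps : seq (seq k)) (ds : seq k) : seq k :=
  flatten [seq rcons pd.1 pd.2 | pd <- zip ps ds] ++ last [::] ps.

Definition factorization (w : seq k) (n : nat)
    (ps : seq (seq k)) (ds : seq k) : Prop :=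
  [/\ size ps = n.+1,
      size ds = n,
      forall p, p \in ps -> wordP p
    & w = interleave ps ds].

End Words.

Arguments wordA k : clear implicits.
Arguments wordC k : clear implicits.
Arguments wordA_len k l : clear implicits.
Arguments wordC_len k l : clear implicits.
Arguments wordP_len k l : clear implicits.

(* Main.v *)
(* The bottom row of a prefix product follows the recurrence
   (c, d) |-> (d, alpha d - c), and never vanishes.  Whenever d = 0 the next
   letter is irrelevant and leads to a nonzero multiple of the initial row
   (0, 1); hence, for p in A, the word p delta v is in A iff v is, and
   cutting w at its first prefix in A gives existence and uniqueness of the
   factorization.  While d != 0, exactly one letter, c / d, leads to d = 0:
   words in P of length l choose each of their first l - 1 letters among q - 1
   and have their last letter forced. *)
Require Import Defs.
From mathcomp Require Import all_boot all_order all_algebra.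

Set Implicit Arguments.
Unset Strict Implicit.
Unset Printing Implicit Defensive.
Import GRing.Theory.
Local Open Scope ring_scope.

Section Factorization.
Variable k : fieldType.
Implicit Types (a c d : k) (w p s v : seq k).

(* The last entry of the row (c, d) times word_mx w. *)
Definition row_last c d w : k :=
  c * word_mx w ord0 ord_max + d * word_mx w ord_max ord_max.

Lemma row_last_nil c d : row_last c d [::] = d.
Proof. by rewrite /row_last /word_mx big_nil !mxE /= mulr0 add0r mulr1. Qed.

Lemma row_last_cons c d a w : row_last c d (a :: w) = row_last d (a * d - c) w.
Proof.
rewrite /row_last /word_mx big_cons !mxE !big_ord_recl !big_ord0 !mxE /=.
have -> : lift ord0 ord0 = ord_max :> 'I_2 by apply/val_inj.
rewrite mul0r mulN1r mul1r !(add0r, addr0) mulrDr mulrBl mulrN.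
by rewrite mulrA (mulrC d a) addrC -addrA.
Qed.

Lemma row_last0 d w : row_last 0 d w = d * row_last 0 1 w.
Proof. by rewrite /row_last !mul0r !add0r mul1r. Qed.

Lemma wordAE w : (w \in wordA k) = (row_last 0 1 w == 0).
Proof. by rewrite /row_last mul0r add0r mul1r. Qed.

Lemma nil_notin_wordA : [::] \notin wordA k.
Proof. by rewrite wordAE row_last_nil oner_eq0. Qed.

(** The row stays nonzero along [p] because letter matrices are invertible. Once it has the form (c,
    0), any letter [a] turns it into (0, -c), so [x] is minus the first entry of the row reached
    after [p]. *)
Lemma row_last_cut c d p : (c != 0) || (d != 0) -> row_last c d p = 0 ->
  exists2 x, x != 0 & forall a v, row_last c d (p ++ a :: v) = x * row_last 0 1 v.
Proof.
elim: p c d => [|b p IHp] c d nz_cd.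
  rewrite row_last_nil => d0; rewrite d0 eqxx orbF in nz_cd *.
  exists (- c) => [|a v]; first by rewrite oppr_eq0.
  by rewrite row_last_cons mulr0 sub0r row_last0.
rewrite row_last_cons => /IHp[|x nz_x Ex].
  by case: (eqVneq d 0) nz_cd => //= ->; rewrite mulr0 sub0r oppr_eq0 orbF.
by exists x => // a v; rewrite cat_cons row_last_cons Ex.
Qed.

Lemma wordA_cut p a v :
  p \in wordA k -> (p ++ a :: v \in wordA k) = (v \in wordA k).
Proof.
rewrite !wordAE => /eqP /row_last_cut[|x nz_x ->]; first by rewrite oner_eq0 orbT.
by rewrite mulf_eq0 (negPf nz_x).
Qed.

(** Membership in P, for an arbitrary starting row instead of (0, 1): reading a letter changes the
    row, so both the proofs by induction and the count need this generality. *)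
Fixpoint first_zero c d w : bool :=
  if w is a :: v then (d != 0) && first_zero d (a * d - c) v else d == 0.

Lemma first_zeroP c d w :
  reflect (row_last c d w = 0 /\
           forall h, (h < size w)%N -> row_last c d (take h w) != 0)
          (first_zero c d w).
Proof.
elim: w c d => [|a w IHw] c d /=.
  by rewrite row_last_nil; apply: (iffP eqP) => [|[]].
rewrite row_last_cons; apply: (iffP andP) => [[nz_d /IHw[z_w nz_w]]|[z_w nz_w]].
  split=> // -[|h]; first by rewrite row_last_nil.
  by rewrite ltnS /= row_last_cons; apply: nz_w.
split; first by have := nz_w 0 isT; rewrite row_last_nil.
by apply/IHw; split=> // h lt_h; have := nz_w h.+1 lt_h; rewrite row_last_cons.
Qed.

Lemma first_zero_wordA w :
  reflect (w \in wordA k /\ forall h, (h < size w)%N -> take h w \notin wordA k)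
          (first_zero 0 1 w).
Proof.
apply: (iffP (first_zeroP _ _ _)); rewrite wordAE => -[Aw Cw].
  by split=> [|h /Cw]; [apply/eqP | rewrite wordAE].
by split=> [|h /Cw]; [apply/eqP | rewrite wordAE].
Qed.

Lemma wordP_lenE l w : (w \in wordP_len k l) = (size w == l) && first_zero 0 1 w.
Proof.
rewrite inE /wordA_len inE -andbA.
have [<-|//] := eqVneq (size w) l; last by rewrite andbF.
rewrite /=; apply/andP/first_zero_wordA => -[Aw Cw]; split=> //.
  (* The definition of [wordP_len] skips h = 0; there the prefix is empty, hence not in A. *)
  case=> [_|h lt_h]; first by rewrite take0 nil_notin_wordA.
  by have /forallP/(_ (Ordinal lt_h))/andP[] := Cw.
apply/forallP=> h; apply/implyP=> _.
by rewrite inE; apply/andP; split; [exact: Cw | rewrite size_takel // ltnW].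
Qed.

Lemma wordPE w : wordP w <-> first_zero 0 1 w.
Proof.
split=> [[l _]|Pw]; first by rewrite wordP_lenE => /andP[].
exists (size w); last by rewrite wordP_lenE eqxx.
(* The length is positive because the starting row (0, 1) does not end in 0. *)
by case: w Pw => //=; rewrite oner_eq0.
Qed.

Lemma wordP_wordA w : wordP w -> w \in wordA k.
Proof. by move=> /wordPE/first_zero_wordA[]. Qed.

(** The shortest prefix of [w] in A works: its minimality is the condition on proper prefixes. *)
Lemma wordP_prefix_exists w : w \in wordA k -> exists p s, wordP p /\ w = p ++ s.
Proof.
move=> Aw; have exh : exists h, take h w \in wordA k.
  by exists (size w); rewrite take_size.
case: (ex_minnP exh) => h Ah min_h; exists (take h w), (drop h w).
split; last by rewrite cat_take_drop.
apply/wordPE/first_zero_wordA; split=> // i; rewrite size_take_min ltn_min.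
case/andP=> lt_ih _; rewrite take_takel 1?ltnW //.
by apply: contraL lt_ih; rewrite -leqNgt => /min_h.
Qed.

(** P is a prefix code: the shorter of [p] and [p'] is a prefix of the other and lies in A, so it
    cannot be a proper prefix. *)
Lemma wordP_prefix_unique p p' s s' :
  wordP p -> wordP p' -> p ++ s = p' ++ s' -> p = p' /\ s = s'.
Proof.
wlog le_pp' : p p' s s' / (size p <= size p')%N => [thesis|] Pp Pp' eq_ps.
  have [/thesis|/ltnW/thesis] := leqP (size p) (size p'); first exact.
  by case/(_ _ _ Pp' Pp (esym eq_ps)) => -> ->.
have Ep : take (size p) p' = p.
  by rewrite -(takel_cat s' le_pp') -eq_ps take_size_cat.
have eq_sz : size p = size p'.
  apply/eqP; rewrite eqn_leq le_pp' leqNgt.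
  have /wordPE/first_zero_wordA[_ Cp'] := Pp'.
  by apply/negP=> /Cp'; rewrite Ep wordP_wordA.
by move/eqP: eq_ps; rewrite eqseq_cat // => /andP[/eqP-> /eqP->].
Qed.

Lemma interleave_cons2 p p' (ps : seq (seq k)) a (ds : seq k) :
  interleave [:: p, p' & ps] (a :: ds) = p ++ a :: interleave (p' :: ps) ds.
Proof. by rewrite /interleave /= cat_rcons -!catA. Qed.

(** Peeling off the first block [p], [a] leaves a factorization of the rest, which is the form
    suited to induction. *)
Variant factorization_spec w : nat -> seq (seq k) -> seq k -> Prop :=
  | FactorizationOne of wordP w : factorization_spec w 0 [:: w] [::]
  | FactorizationCons p a v n ps ds of
      wordP p & w = p ++ a :: v & factorization v n ps ds :
      factorization_spec w n.+1 (p :: ps) (a :: ds).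

Lemma factorizationP w n (ps : seq (seq k)) (ds : seq k) :
  factorization w n ps ds <-> factorization_spec w n ps ds.
Proof.
split=> [[]|[Pw|p a v {}n {}ps {}ds Pp -> [sz_ps sz_ds Pps ->]]].
- case: n ds ps => [|n] [|a ds] // [|p [|p' ps]] // sz_ps sz_ds Pps ->.
    by apply: FactorizationOne; apply: Pps; rewrite /= inE.
  rewrite interleave_cons2; apply: FactorizationCons (erefl _) _.
    by apply: Pps; rewrite inE eqxx.
  have [sz_ps' sz_ds'] : size (p' :: ps) = n.+1 /\ size ds = n.
    by case: sz_ps sz_ds => <- [->].
  by split=> // x ps_x; apply: Pps; rewrite inE ps_x orbT.
- by split=> // p; rewrite inE => /eqP->.
split=> [|||]; rewrite /= ?sz_ps ?sz_ds //.
  by move=> x /[!inE] /predU1P[->|/Pps].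
by case: ps sz_ps {Pps} => // p' ps _; rewrite interleave_cons2.
Qed.

Lemma factorization_wordA n w (ps : seq (seq k)) (ds : seq k) :
  factorization w n ps ds -> w \in wordA k.
Proof.
elim: n w ps ds => [|n IHn] w ps ds /factorizationP.
  by move E: 0%N => m F; case: F E => // /wordP_wordA.
move E: n.+1 => m F; case: F E => // p a v n' {}ps {}ds Pp -> Fv [En].
by rewrite -En in Fv; rewrite (wordA_cut a v (wordP_wordA Pp)); apply: IHn Fv.
Qed.

Lemma wordA_factorization w : w \in wordA k ->
  exists n (ps : seq (seq k)) (ds : seq k), factorization w n ps ds.
Proof.
have [m] := ubnP (size w); elim: m w => // m IHm w lt_w Aw.
have [p [[|a v] [Pp Ew]]] := wordP_prefix_exists Aw.
  exists 0, [:: w], [::]; apply/factorizationP/FactorizationOne.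
  by rewrite Ew cats0.
have Av : v \in wordA k by rewrite -(wordA_cut a v (wordP_wordA Pp)) -Ew.
have [|n [ps [ds Fv]]] := IHm v _ Av.
  by move: lt_w; rewrite Ew size_cat /= addnS !ltnS; apply/leq_trans/leq_addl.
exists n.+1, (p :: ps), (a :: ds).
by apply/factorizationP; apply: FactorizationCons Ew Fv.
Qed.

Lemma factorization_unique n n' w (ps ps' : seq (seq k)) (ds ds' : seq k) :
  factorization w n ps ds -> factorization w n' ps' ds' ->
  [/\ n = n', ps = ps' & ds = ds'].
Proof.
have [m] := ubnP (size w); elim: m w n n' ps ps' ds ds' => // m IHm w n n'.
move=> ps ps' ds ds' lt_w /factorizationP F /factorizationP F'.
case: F F' => [Pw|p a v {}n {}ps {}ds Pp Ew Fv]; case=>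
  [Pw'|p' a' v' {}n' {}ps' {}ds' Pp' Ew' Fv'] //.
(* If [w] is itself in P, comparing it with a longer factorization would equate the empty tail with
   [a' :: v']. *)
- by have [|||_] := @wordP_prefix_unique w p' [::] (a' :: v'); rewrite ?cats0.
- by have [|||_] := @wordP_prefix_unique w p [::] (a :: v); rewrite ?cats0.
have [-> [<- Evv']] : p = p' /\ a :: v = a' :: v'.
  by apply: wordP_prefix_unique; rewrite // -Ew.
rewrite -{}Evv' in Fv'.
have [|-> -> ->] // := IHm v n n' ps ps' ds ds' _ Fv Fv'.
by move: lt_w; rewrite Ew size_cat /= addnS !ltnS; apply/leq_trans/leq_addl.
Qed.

End Factorization.

Lemma big_tuple_nil (T : finType) (F : seq T -> nat) :
  (\sum_(w : 0.-tuple T) F w = F [::])%N.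
Proof. by rewrite (big_pred1 [tuple]) // => w; apply/esym/eqP; exact: tuple0. Qed.

(** Splitting off the first letter lets a count over tuples follow the recursion of [first_zero]. *)
Lemma big_tuple_cons (T : finType) l (F : seq T -> nat) :
  (\sum_(w : l.+1.-tuple T) F w = \sum_(a : T) \sum_(v : l.-tuple T) F (a :: v))%N.
Proof.
rewrite pair_big (reindex (fun x : T * l.-tuple T => [tuple of x.1 :: x.2])) //=.
exists (fun w : l.+1.-tuple T => (thead w, [tuple of behead w])) => [[a v]|w] _.
  by congr (_, _); apply/val_inj.
by rewrite /= -tuple_eta.
Qed.

Section Counting.
Variable k : finFieldType.
Implicit Types (c d : k) (l : nat).

Lemma sum_first_zero l c d : d != 0 ->
  (\sum_(w : l.+1.-tuple k) first_zero c d w)%N = ((#|k| - 1) ^ l)%N.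
Proof.
elim: l c d => [|l IHl] c d nz_d;
  rewrite (big_tuple_cons _ (fun w => first_zero c d w)) /= nz_d /=.
  (* One-letter words: only c / d brings the last entry to 0. *)
  rewrite (bigD1 (c / d)) //= (big_tuple_nil (fun v => first_zero d _ v)) /=.
  rewrite divfK // subrr eqxx big1 // => a ne_a.
  rewrite (big_tuple_nil (fun v => first_zero d (a * d - c) v)) /= subr_eq0.
  by case: eqP => // E; rewrite -E mulfK ?eqxx in ne_a.
(* Here c / d reaches 0 while letters remain, so it contributes nothing; each of the other letters
   keeps the last entry nonzero and falls under the induction hypothesis. *)
rewrite (bigD1 (c / d)) //= [X in (X + _)%N]big1 ?add0n => [|v _]; last first.
  by rewrite divfK // subrr; case/tupleP: v => b v /=; rewrite eqxx.
rewrite (eq_bigr (fun=> ((#|k| - 1) ^ l)%N)) => [|a ne_a].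
  by rewrite sum_nat_const cardC1 -subn1 expnS.
apply: IHl; rewrite subr_eq0; apply: contraNneq ne_a => <-.
by rewrite mulfK.
Qed.

End Counting.

Local Close Scope ring_scope.

Theorem theorem2p6 :
  (forall (k : fieldType) (w : seq k),
     (w \in wordA k <->
        exists (n : nat) (ps : seq (seq k)) (ds : seq k),
          factorization w n ps ds)
     /\ (w \in wordA k ->
          forall (n n' : nat) (ps ps' : seq (seq k)) (ds ds' : seq k),
            factorization w n ps ds -> factorization w n' ps' ds' ->
            [/\ n = n', ps = ps' & ds = ds']))
  /\
  (forall (k : finFieldType) (q l : nat), #|k| = q -> (1 <= l)%N ->
     #|[set w : l.-tuple k | (w : seq k) \in wordP_len k l]|
       = (q - 1) ^ (l - 1)).
Proof.
split=> [k w|k q [//|l] <- _].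
  split=> [|_ n n' ps ps' ds ds']; last exact: factorization_unique.
  split=> [|[n [ps [ds]]]]; first exact: wordA_factorization.
  exact: factorization_wordA.
(* The cardinal becomes a sum of 0-1 indicators, with starting row (0, 1). *)
rewrite [l.+1 - 1]subn1 -(sum_first_zero l 0%R (oner_neq0 k)) -sum1_card big_mkcond.
by apply: eq_bigr => w _; rewrite inE wordP_lenE size_tuple eqxx; case: first_zero.
Qed.
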